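(* For all $n\ge 2$, $\mathrm{r}_n(1243)=\dfrac{n^3}{3}-\dfrac{7n}{3}+4$.
   Context: $\mathcal{S}_n$ is the set of permutations of $[n]$, $\pi^r$ the reversal of $\pi$. A word $w$ contains $\rho\in\mathcal{S}_k$ if some subsequence $w_{i_1}\cdots w_{i_k}$ ($i_1<\cdots<i_k$) satisfies $w_{i_a}\le w_{i_b}$ iff $\rho_a\le\rho_b$; otherwise it avoids $\rho$. $\mathcal{R}_n=\{\pi\pi^r:\pi\in\mathcal{S}_n\}$ (concatenation of $\pi$ with its reversal), and $\mathrm{r}_n(\rho)$ is the number of members of $\mathcal{R}_n$ avoiding $\rho$. *)

(* Defs.v *)
From mathcomp Require Import all_boot all_fingroup.

Set Implicit Arguments.
Unset Strict Implicit.
Unset Printing Implicit Defensive.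

(* Letters, positions and pattern entries are 0-based: 'I_n = {0, .., n-1}
   stands for [n] = {1, .., n}, and 'S_n for the permutations of [n]. *)

Definition one_line (n : nat) (pi : 'S_n) : n.-tuple 'I_n :=
  [tuple pi i | i < n].

Definition contains (k m n : nat) (rho : 'S_k) (w : m.-tuple 'I_n) : bool :=
  [exists i : {ffun 'I_k -> 'I_m},
    [forall a : 'I_k, forall b : 'I_k, (a < b) ==> (i a < i b)] &&
    [forall a : 'I_k, forall b : 'I_k,
      (tnth w (i a) <= tnth w (i b)) == (rho a <= rho b)]].

Definition avoids (k m n : nat) (rho : 'S_k) (w : m.-tuple 'I_n) : bool :=
  ~~ contains rho w.

Definition rev_double (n : nat) (pi : 'S_n) : (n + n).-tuple 'I_n :=
  [tuple of one_line pi ++ rev (one_line pi)].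

Definition Rset (n : nat) : {set (n + n).-tuple 'I_n} :=
  [set rev_double pi | pi : 'S_n].

Definition r (n k : nat) (rho : 'S_k) : nat :=
  #|[set w in Rset n | avoids rho w]|.

(* 1243 differs from the identity 1234 by exchanging its last two entries. *)
Definition p1243 : 'S_4 := tperm (@Ordinal 4 2 isT) (@Ordinal 4 3 isT).

Lemma one_line_p1243 :
  [seq (val x).+1 | x <- one_line p1243] = [:: 1; 2; 4; 3].
Proof.
by rewrite /one_line /= -map_comp /= !enum_ordSl enum_ord0 /= !permE.
Qed.

(* Main.v *)
Require Import Defs.
From mathcomp Require Import all_boot all_fingroup all_algebra.
From mathcomp Require Import zify lra.

(* Let p v be the position of the letter v in pi. The word pi pi^r contains
   1243 iff some letters a < b < c < d satisfy p a < p b < p d, or p a < p b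
   and p c < p d, or p c < p d < p b. For an avoider, let b be the least letter
   preceded by a smaller one (if there is none, pi is decreasing). Then the
   letters below b, and those above b, are each in decreasing order, and
   letters above b + 1 precede b. Apart from 0, pi is n-1 ... b, possibly with
   b and b+1 swapped, with the block b-1 ... 1 inserted contiguously before b
   (and before b+1); 0 is inserted anywhere after the block. Counting the
   possible choices gives the cubic. *)

(** * Admissible orders and their parameters *)

Definition admissible (n : nat) (f : nat -> nat) : Prop :=
  forall a b c d, a < b -> b < c -> c < d -> d < n ->
  ~~ [|| (f a < f b) && (f b < f d), (f a < f b) && (f c < f d)
       | (f c < f d) && (f d < f b)].

(* Position, among the letters other than 0, of the letter v > 0 in the avoider
   with parameters b, y, e: the block b-1 ... 1 comes after y - b of the large
   letters n-1 ... b, and e records the swap of b and b+1. *)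
Definition rank (n b y : nat) (e : bool) (v : nat) : nat :=
  if v < b then y - 1 - v else
  let q := if e && (v == b) then n - 2 - b
           else if e && (v == b.+1) then n - 1 - b else n - 1 - v in
  if q < y - b then q else q + b - 1.

Definition place (n b y z : nat) (e : bool) (v : nat) : nat :=
  if v == 0 then z else
  let k := rank n b y e v in if k < z then k else k.+1.

(* For b = 1 the block is empty, so y is redundant and normalised to 1; then
   e with 0 after the letter 1 is already obtained from b = 2. *)
Definition param_ok (n b y z : nat) (e : bool) : bool :=
  [&& 0 < b <= y, y + e < n, (b == 1) ==> (y == 1), y <= z.+1, z < n
    & (b == 1) && e ==> (z + 2 < n)].

Ltac split_ifs :=
  repeat match goal with |- context [if ?c then _ else _] =>
    lazymatch c with
    | context [if _ then _ else _] => fail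
    | _ => case: (boolP c) => /= ?
    end
  end.

(** * The order defined by the parameters *)

(** A large letter follows the block iff at least [y - b] large letters precede it; [y + e < n]
    keeps a swapped pair [b], [b.+1] behind the block. *)
Lemma rank_lt n b y (e : bool) x v : 0 < b <= y -> y + e < n -> 0 < x < v ->
  v < n ->
  (rank n b y e x < rank n b y e v) =
  if x < b then (b <= v) && ((e && (v <= b.+1)) || (v + y < n + b))
  else [&& e, x == b & v == b.+1].
Proof.
rewrite /rank; case: e => /= by0 yn x0 vn;
  split_ifs; lia.
Qed.

Lemma rank_inj n b y (e : bool) x v : 0 < b <= y -> y + e < n -> 0 < x < v ->
  v < n -> rank n b y e x <> rank n b y e v.
Proof.
rewrite /rank; case: e => /= by0 yn x0 vn;
  split_ifs; lia.
Qed.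

Lemma rank_bound n b y (e : bool) x : 0 < b <= y -> y + e < n -> 0 < x < n ->
  rank n b y e x < n.-1.
Proof.
rewrite /rank; case: e => /= by0 yn x0; split_ifs; lia.
Qed.

Lemma place_lt n b y z (e : bool) x v : 0 < b <= y -> y + e < n -> x < v < n ->
  (place n b y z e x < place n b y z e v) =
  if x == 0 then z <= rank n b y e v else
  if x < b then (b <= v) && ((e && (v <= b.+1)) || (v + y < n + b))
  else [&& e, x == b & v == b.+1].
Proof.
move=> by0 yn xv; rewrite /place; have -> : v == 0 = false by lia.
case: (x == 0) /eqP => ?; first by case: ifP => ?; lia.
by rewrite -rank_lt //; try lia; do ! case: ifP => ?; lia.
Qed.

Lemma place_bound n b y z (e : bool) x : 0 < b <= y -> y + e < n -> z < n ->
  x < n -> place n b y z e x < n.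
Proof.
move=> by0 yn zn xn; rewrite /place; case: eqP => // ?.
by have := @rank_bound n b y e x by0 yn; case: ifP; lia.
Qed.

Lemma place_inj n b y z (e : bool) x v : 0 < b <= y -> y + e < n ->
  x < v < n -> place n b y z e x <> place n b y z e v.
Proof.
move=> by0 yn xv; rewrite /place; have -> : v == 0 = false by lia.
case: (x == 0) /eqP => ?; first by case: ifP => ?; lia.
by have := @rank_inj n b y e x v by0 yn; do ! case: ifP => ?; lia.
Qed.

Lemma place_admissible n b y z e :
  param_ok n b y z e -> admissible n (place n b y z e).
Proof.
case/and5P=> by0 yn b1 yz /andP[zn ze] x1 x2 x3 x4 l12 l23 l34 l4n.
have -> : (place n b y z e x4 < place n b y z e x2) =
         ~~ (place n b y z e x2 < place n b y z e x4).
  by have := @place_inj n b y z e x2 x4; lia.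
rewrite !place_lt //; try lia.
(* For [x1 = 0] this, with [y <= z.+1], puts 0 after every letter of the block. *)
have : x2 < b -> rank n b y e x2 = y - 1 - x2 by rewrite /rank => ->.
case: e yn ze => /= yn ze; split_ifs; lia.
Qed.

(** * Every admissible order comes from parameters *)

Lemma admissible_form n f : 1 < n -> {in gtn n &, injective f} ->
  admissible n f ->
  exists b y (e : bool), [/\ 0 < b <= y, y + e < n, (b == 1) ==> (y == 1),
    (if b == 1 then e ==> (f 0 < f 1) else f 1 < f 0)
  & forall x v, 0 < x < v -> v < n ->
     (f x < f v) = (rank n b y e x < rank n b y e v)].
Proof.
move=> n1 finj fadm.
have fneq x v : x < v < n -> f x <> f v.
  by move=> xv /finj; rewrite !inE => /(_ ltac:(lia) ltac:(lia)); lia.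
pose P v := (v < n) && has (fun a => f a < f v) (iota 0 v).
have notP v x : ~~ P v -> x < v < n -> f v < f x.
  move=> nP xv; have := fneq x v xv; case: (ltngtP (f x) (f v)) => // fxv _.
  case/negP: nP; rewrite /P; apply/andP; split; first lia.
  by apply/hasP; exists x => //; rewrite mem_iota; lia.
have [/hasP[v0 v0n Pv0]|/hasPn nP] := boolP (has P (iota 0 n)); last first.
  exists 1, 1, false; split=> //=; try lia.
  move=> x v x0 vn; rewrite rank_lt; try lia.
  have : f v < f x by apply: notP; [apply: nP; rewrite mem_iota|]; lia.
  by split_ifs; lia.
have exP : exists v, P v by exists v0.
(* The letters below b, and those above b, are in decreasing order. *)
case: (ex_minnP exP) => b /andP[bn /hasP[a]]; rewrite mem_iota => ab fab bmin.
have low x v : x < v < b -> f v < f x.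
  move=> xv; apply: notP; last lia.
  by apply/negP => /bmin; lia.
have up c d : b < c < d -> d < n -> f d < f c.
  move=> bcd dn; have := fadm a b c d; have := fneq c d; lia.
(* By [low], [b.-1] comes last among the letters below [b], so no later than [a]. *)
have b1b : f b.-1 < f b.
  have [ab1|ab1] := eqVneq a b.-1; first by rewrite -ab1.
  by have := low a b.-1; lia.
have [b1|bne1] := eqVneq b 1.
  subst b; rewrite /= in b1b; exists 1, 1, ((2 < n) && (f 1 < f 2)); split=> //=; try lia.
  move=> x v x0 vn; rewrite rank_lt; try lia.
  have -> : x < 1 = false by lia.
  have [x1|x1] := eqVneq x 1; last by have := up x v; lia.
  subst x.
  have [v2|v2] := eqVneq v 2; first by subst v; lia.
  by have := fadm 0 1 2 v; have := fneq 1 v; lia.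
(* Otherwise [b.-1], [b], [l] occur in this order, the third forbidden case with 0 as smallest
   letter. *)
have lowb l : 0 < l < b -> f l < f b.
  move=> lb; have [->//|l1] := eqVneq l b.-1.
  by have := fadm 0 l b.-1 b; have := fneq l b; lia.
pose e := (b.+1 < n) && (f b < f b.+1).
have bup v : b < v < n -> (f b < f v) = (v == b.+1) && e.
  rewrite /e => bv; case: (ltngtP v b.+1) => vb; try lia; last by subst v; lia.
  by have := fadm b.-1 b b.+1 v; have := fneq b v; lia.
(* With [m] the largest letter after [b.-1], the large letters after the block are exactly [b], ...,
   [m]. *)
pose Q v := (v < n) && (f b.-1 < f v).
have Qb : Q b by rewrite /Q bn b1b.
have exQ : exists v, Q v by exists b.
have Qle v : Q v -> v <= n by case/andP; lia.
case: (ex_maxnP exQ Qle) => m /andP[mn bm] mmax.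
have bem : b + e <= m.
  have := mmax _ Qb; have := mmax b.+1; rewrite /Q.
  by case: (boolP e) => /=; rewrite /e; lia.
have bmv v : b <= v < n -> (f b.-1 < f v) = (v <= m).
  move=> bv; case: (leqP v m) => vm; last first.
    by apply/negbTE/negP => bv'; have := mmax v; rewrite /Q; lia.
  have [->//|vb] := eqVneq v b; have [->//|vm'] := eqVneq v m.
  by have := up v m; lia.
(* Here [y - b] is [n - 1 - m], the number of letters above [m], which precede the block. *)
exists b, (b + n - 1 - m), e; split; try lia.
  by rewrite (negbTE bne1); apply: low; lia.
move=> x v x0 vn; rewrite rank_lt; try lia.
case: ifP => xb; last first.
  have [->|xb'] := eqVneq x b; first by rewrite bup; lia.
  by have := up x v; lia.
have [vb|vb] := ltnP v b; first by have := low x v; lia.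
(* The block is contiguous: [v] between [x] and [b.-1] would give the third forbidden case with 0,
   [x], [b.-1], [v]. *)
have -> : (f x < f v) = (f b.-1 < f v).
  have [->//|xb1] := eqVneq x b.-1.
  have := low x b.-1; have := fneq x v.
  have [->|vb'] := eqVneq v b; first by have := lowb x; lia.
  by have := fadm 0 x b.-1 v; lia.
by rewrite bmv; lia.
Qed.

(** * Uniqueness of the parameters *)

(** If [1 < b' < b], the letters [b'.-1] and [b'] are ordered oppositely by the two sides. If
    [b' = 1], comparing [b.-1] with [b] forces [b = 2] and [e']; then 0 precedes 1 on the primed
    side only. *)
Lemma place_param_le n b y z (e : bool) b' y' (e' : bool) :
  param_ok n b y z e -> param_ok n b' y' z e' ->
  (forall v, v < n -> place n b y z e v = place n b' y' z e' v) -> b <= b'.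
Proof.
case/and5P=> by0 yn b1 yz /andP[zn ze] /and5P[by0' yn' b1' yz' /andP[zn' ze']] eqp.
rewrite leqNgt; apply/negP => bb.
have eqlt x v : x < v < n -> (place n b y z e x < place n b y z e v) =
    (place n b' y' z e' x < place n b' y' z e' v).
  by move=> xv; rewrite !eqp //; lia.
have [b'1|b'1] := eqVneq b' 1; last first.
  by have := eqlt b'.-1 b'; rewrite !place_lt; try lia; split_ifs; lia.
subst b'; have := eqlt b.-1 b; have := eqlt 0 1; rewrite !place_lt //; try lia.
have -> : rank n b y e 1 = y - 2 by rewrite /rank bb; lia.
have : n - 3 <= rank n 1 y' e' 1 by rewrite /rank; case: (e') => /=; split_ifs; lia.
case: e' yn' ze' eqp eqlt => /= yn' ze' _ _; split_ifs; try lia.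
Qed.

Lemma place_param_inj n b y z (e : bool) b' y' z' (e' : bool) :
  param_ok n b y z e -> param_ok n b' y' z' e' ->
  (forall v, v < n -> place n b y z e v = place n b' y' z' e' v) ->
  [/\ b = b', y = y', z = z' & e = e'].
Proof.
move=> ok ok' eqp.
have zz : z = z'.
  by have := eqp 0; rewrite /place /=; apply; case/and5P: ok => *; lia.
subst z'; have bb : b = b'.
  apply/eqP; rewrite eqn_leq; apply/andP; split.
    by apply: place_param_le ok ok' eqp.
  by apply: place_param_le ok' ok _ => v vn; rewrite eqp.
subst b'; case/and5P: ok ok' => by0 yn b1 yz /andP[zn ze].
case/and5P=> by0' yn' b1' yz' /andP[zn' ze'].
have yy : y = y'.
  have [?|bne1] := eqVneq b 1; first by lia.
  (* The last block letter [b.-1] sits at position [y - b], before 0. *)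
  have := eqp b.-1; rewrite /place /rank; split_ifs; lia.
subst y'; split=> //.
(* Without a letter [b.+1], the bounds on [y] force both flags to be false; otherwise the order of
   [b] and [b.+1] reveals the flag. *)
have [bn|bn] := ltnP b.+1 n; last by move: yn yn'; case: (e); case: (e') => /=; lia.
have : (place n b y z e b < place n b y z e b.+1) =
    (place n b y z e' b < place n b y z e' b.+1) by rewrite !eqp //; lia.
rewrite !place_lt //; try lia.
by case: (e); case: (e'); split_ifs; lia.
Qed.

(** * Recovering a permutation from relative order *)

Lemma card_ord_lt n k : k <= n -> #|[set x : 'I_n | x < k]| = k.
Proof.
move=> kn; have -> : [set x : 'I_n | x < k] = [set widen_ord kn x | x in 'I_k].
  apply/setP=> x; rewrite inE; apply/idP/imsetP => [xk|[u _ ->]] //=.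
  by exists (Ordinal xk) => //; apply: val_inj.
by rewrite card_imset ?card_ord // => u v /(congr1 val) /= /val_inj.
Qed.

Lemma card_lt_inj n (g : 'I_n -> 'I_n) x :
  injective g -> #|[set y | g y < g x]| = g x.
Proof.
move=> gi; rewrite -[RHS](@card_ord_lt n) ?(ltnW (ltn_ord _)) //.
have -> : [set y | g y < g x] = g @^-1: [set y : 'I_n | y < g x].
  by apply/setP=> y; rewrite !inE.
by apply: on_card_preimset; apply: onW_bij; apply: injF_bij.
Qed.

(** Each value of a bijection counts the smaller values. Away from [i] the counts agree, and the
    common value at [i] decides whether to add one. *)
Lemma same_order_eq n (g h : 'I_n -> 'I_n) (i : 'I_n) :
  injective g -> injective h -> g i = h i ->
  (forall x y, x != i -> y != i -> (g x < g y) = (h x < h y)) -> g =1 h.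
Proof.
move=> gi hi ghi gh x; have [->//|xi] := eqVneq x i.
have split_card (k : 'I_n -> 'I_n) : injective k ->
    k x = (k i < k x) + #|[set y | k y < k x] :\ i| :> nat.
  by move=> ki; rewrite -{1}(card_lt_inj _ _ _ ki) (cardsD1 i) inE.
have := split_card g gi; have := split_card h hi.
have -> : [set y | g y < g x] :\ i = [set y | h y < h x] :\ i.
  by apply/setP=> y; rewrite !inE; case: eqVneq => //= yi; rewrite gh.
have gxi : g x <> g i :> nat by move/val_inj/gi/eqP; rewrite (negbTE xi).
have hxi : h x <> h i :> nat by move/val_inj/hi/eqP; rewrite (negbTE xi).
by move=> hx gx; apply: val_inj; move: hx gx gxi; rewrite /= ghi; lia.
Qed.

(** * From pattern containment to positions of letters *)

Lemma contains1243P m n (w : m.-tuple 'I_n) :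
  reflect (exists j0 j1 j2 j3 : 'I_m, [/\ j0 < j1, j1 < j2, j2 < j3 &
    [/\ tnth w j0 < tnth w j1, tnth w j1 < tnth w j3
      & tnth w j3 < tnth w j2]])
  (contains p1243 w).
Proof.
apply: (iffP existsP) => [[i /andP[/forallP iinc /forallP ipat]]|].
  pose o k (lt : k < 4) : 'I_4 := Ordinal lt.
  have inc (a b : 'I_4) : a < b -> i a < i b by move: (forallP (iinc a) b) => /implyP.
  have pat (a b : 'I_4) : (tnth w (i a) < tnth w (i b)) = (p1243 a < p1243 b).
    by rewrite !ltnNge (eqP (forallP (ipat b) a)).
  exists (i (o 0 isT)), (i (o 1 isT)), (i (o 2 isT)), (i (o 3 isT)).
  by split; try (by apply: inc); split; rewrite pat !permE.
move=> [j0 [j1 [j2 [j3 [l01 l12 l23 [w01 w13 w32]]]]]].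
exists [ffun a => tnth [tuple j0; j1; j2; j3] a].
apply/andP; split; apply/forallP => a; apply/forallP => b; rewrite !ffunE.
  case: a b => [[|[|[|[|//]]]] ?] [[|[|[|[|//]]]] ?] //=;
    rewrite !(tnth_nth j0) /=; lia.
rewrite !permE; case: a b => [[|[|[|[|//]]]] ?] [[|[|[|[|//]]]] ?] //=;
  rewrite !(tnth_nth j0) /=; lia.
Qed.

Lemma position_rev_double n (pi : 'S_n) (j : 'I_(n + n)) :
  (pi^-1)%g (tnth (rev_double pi) j) = (if j < n then nat_of_ord j else n + n - 1 - j) :> nat.
Proof.
have nth_ol x0 (i : 'I_n) : nth x0 (one_line pi) i = pi i.
  by rewrite -tnth_nth tnth_mktuple.
have sz : size (one_line pi) = n by rewrite size_tuple.
have x0 : 'I_n by case: n pi j nth_ol sz => [|n] pi j _ _; [case: j|exact: ord0].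
rewrite (tnth_nth x0) /= nth_cat sz; case: ltnP => jn.
  by rewrite (nth_ol x0 (Ordinal jn)) permK.
have jn2 := ltn_ord j; rewrite nth_rev sz; last lia.
have kn : n - (j - n).+1 < n by lia.
by rewrite (nth_ol x0 (Ordinal kn)) permK /=; lia.
Qed.

(** The inverse permutation is extended to [nat] so that it can be compared with [place];
    [admissible] never sees the default 0. *)
Definition position n (pi : 'S_n) (v : nat) : nat :=
  if insub v is Some x then (pi^-1)%g x else 0.

Lemma positionE n (pi : 'S_n) (x : 'I_n) : position n pi x = (pi^-1)%g x.
Proof. by rewrite /position valK. Qed.

Lemma position_inj n (pi : 'S_n) : {in gtn n &, injective (position n pi)}.
Proof.
move=> u v; rewrite !inE => un vn.
rewrite (positionE n pi (Ordinal un)) (positionE n pi (Ordinal vn)).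
by move/val_inj/perm_inj/(congr1 val).
Qed.

Lemma avoids1243P n (pi : 'S_n) :
  reflect (admissible n (position n pi)) (avoids p1243 (rev_double pi)).
Proof.
apply: (iffP idP) => [/contains1243P cont a b c d ab bc cd dn|adm].
  apply/negP => bad; apply: cont.
  (* Each letter occurs once in each half; a forbidden order lets the pattern
     take 3, 2 or 1 of its letters from the first half. *)
  pose left (x : 'I_n) : 'I_(n + n) := lshift n ((pi^-1)%g x).
  pose right (x : 'I_n) : 'I_(n + n) := rev_ord (left x).
  have lE x : tnth (rev_double pi) (left x) = x.
    apply: (@perm_inj _ (pi^-1)%g); apply: val_inj.
    by rewrite /= position_rev_double /= ltn_ord.
  have rE x : tnth (rev_double pi) (right x) = x.
    apply: (@perm_inj _ (pi^-1)%g); apply: val_inj.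
    rewrite /= position_rev_double /=; have := ltn_ord ((pi^-1)%g x).
    by case: ifP => ?; lia.
  have cn := ltn_trans cd dn; have bn := ltn_trans bc cn.
  have an := ltn_trans ab bn.
  pose a' := Ordinal an; pose b' := Ordinal bn.
  pose c' := Ordinal cn; pose d' := Ordinal dn.
  have la := ltn_ord ((pi^-1)%g a'); have lb := ltn_ord ((pi^-1)%g b').
  have lc := ltn_ord ((pi^-1)%g c'); have ld := ltn_ord ((pi^-1)%g d').
  move: bad; rewrite (positionE n pi a') (positionE n pi b').
  rewrite (positionE n pi c') (positionE n pi d') => /or3P[]/andP[p1 p2].
  - exists (left a'), (left b'), (left d'), (right c').
    by rewrite !lE !rE; split=> //=; lia.
  - exists (left a'), (left b'), (right d'), (right c').
    by rewrite !lE !rE; split=> //=; lia.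
  - exists (left a'), (right b'), (right d'), (right c').
    by rewrite !lE !rE; split=> //=; lia.
apply/contains1243P => -[j0 [j1 [j2 [j3 [l01 l12 l23 [w01 w13 w32]]]]]].
(* The letters at [j0], [j1], [j3], [j2] serve as a, b, c, d. At least three indices in the first
   half give the first forbidden order, two the second, at most one the third. *)
have := adm _ _ _ _ w01 w13 w32 (ltn_ord _).
rewrite !positionE !position_rev_double; move: (ltn_ord j3).
by split_ifs; lia.
Qed.

(** * Bijection between avoiders and parameters *)

Definition place_fun n (q : 'I_n * 'I_n * 'I_n * bool) : {ffun 'I_n -> 'I_n} :=
  let: (b, y, z, e) := q in [ffun v : 'I_n => insubd v (place n b y z e v)].

Definition params n : {set 'I_n * 'I_n * 'I_n * bool} :=
  [set q : 'I_n * 'I_n * 'I_n * bool |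
    let: (b, y, z, e) := q in param_ok n b y z e].

Lemma place_funE n (b y z : 'I_n) (e : bool) (v : 'I_n) :
  0 < b <= y -> y + e < n -> place_fun n (b, y, z, e) v = place n b y z e v :> nat.
Proof.
by move=> by0 yn; rewrite ffunE val_insubd place_bound ?ltn_ord.
Qed.

Lemma place_fun_inj n : {in params n &, injective (place_fun n)}.
Proof.
move=> [[[b y] z] e] [[[b' y'] z'] e']; rewrite !inE => ok ok' eqF.
have [|/val_inj-> /val_inj-> /val_inj-> -> //] := place_param_inj _ _ _ _ _ _ _ _ _ ok ok'.
case/and5P: ok => by0 yn _ _ _; case/and5P: ok' => by0' yn' _ _ _ v vn.
by rewrite -(place_funE n b y z e (Ordinal vn)) // eqF place_funE.
Qed.

Lemma admissible_ext n f g : (forall v, v < n -> f v = g v) ->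
  admissible n g -> admissible n f.
Proof.
by move=> fg adm a b c d ab bc cd dn; rewrite !fg; first apply: adm; lia.
Qed.

(* The comparison with [place] goes through relative orders: [admissible_form]
   gives the order of the positive letters, and 0 has position z. *)
Lemma avoiders_place n : 1 < n ->
  [set [ffun v => (pi^-1)%g v] | pi : 'S_n & avoids p1243 (rev_double pi)]
  = place_fun n @: params n.
Proof.
move=> n1; apply/setP=> f; apply/imsetP/imsetP => [[pi]|[[[[b y] z] e]]]; last first.
  rewrite inE => ok ->; have [by0 yn _ _ _] := and5P ok.
  have Finj : injective (place_fun n (b, y, z, e)).
    move=> u v /(congr1 val); rewrite /= !place_funE // => eq_uv.
    apply: val_inj => /=; case: (ltngtP u v) => // uv.
      by have := place_inj n b y z e u v; have := ltn_ord v; lia.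
    by have := place_inj n b y z e v u; have := ltn_ord u; lia.
  exists (perm Finj)^-1%g; last by apply/ffunP=> v; rewrite ffunE invgK permE.
  rewrite inE; apply/avoids1243P.
  apply: admissible_ext (place_admissible _ _ _ _ _ ok) => v vn.
  by rewrite (positionE n _ (Ordinal vn)) invgK permE place_funE.
rewrite inE => /avoids1243P adm ->.
have [b [y [e [by0 yn b1 f01 ford]]]] := admissible_form _ _ n1 (position_inj _ pi) adm.
have yltn : y < n by lia.
have bltn : b < n by lia.
pose i0 : 'I_n := Ordinal (ltnW n1); pose z := (pi^-1)%g i0.
pose q : 'I_n * 'I_n * 'I_n * bool := (Ordinal bltn, Ordinal yltn, z, e).
have FE v : place_fun n q v = place n b y z e v :> nat by apply: place_funE.
have eqF : (pi^-1)%g =1 place_fun n q.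
  apply: (same_order_eq _ _ _ i0); first exact: perm_inj.
  - move=> u v /(congr1 val); rewrite /= !FE => eq_uv.
    apply: val_inj => /=; case: (ltngtP u v) => // uv.
      by have := place_inj n b y z e u v; have := ltn_ord v; lia.
    by have := place_inj n b y z e v u; have := ltn_ord u; lia.
  - by apply: val_inj; rewrite /= FE.
  have lt u v : 0 < u -> u < v -> v < n -> (position n pi u < position n pi v)
      = (place n b y z e u < place n b y z e v).
    move=> u0 uv vn; rewrite ford; try lia.
    by rewrite place_lt ?rank_lt; try lia; have -> : u == 0 = false by lia.
  move=> u v; rewrite -!val_eqE /= => u0 v0.
  rewrite !FE -(positionE n pi u) -(positionE n pi v); case: (ltngtP u v) => uv.
  - by rewrite lt ?ltn_ord //; lia.
  - have := lt v u; have := place_inj n b y z e v u; have := ltn_ord u.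
    have := position_inj n pi u v; rewrite !inE; have := ltn_ord v; lia.
  - by rewrite uv !ltnn.
exists q; last by apply/ffunP=> v; rewrite ffunE eqF.
have pE v : v < n -> position n pi v = place n b y z e v.
  by move=> vn; rewrite (positionE _ _ (Ordinal vn)) eqF FE.
rewrite inE /q /param_ok by0 yn b1 ltn_ord /=.
(* The order of 0 and 1 gives the bounds on [z]: 1 before 0 means [y <= z.+1] if [b != 1], and 0
   before 1 means [z + 2 < n] if [b = 1] and [e] holds. *)
move: f01; rewrite !pE; try lia; rewrite [place n b y z e 0]/place /place /rank /=.
have [bone|bone] := eqVneq b 1; last by split_ifs; lia.
by subst b; case: e yn {FE eqF pE q ford} => /= yn; split_ifs; lia.
Qed.

Lemma r1243_card n : 1 < n -> r n p1243 = #|params n|.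
Proof.
move=> n1; rewrite -(card_in_imset (place_fun_inj n)) -avoiders_place //.
rewrite card_imset; last first.
  move=> s t /ffunP eq_st; apply: invg_inj; apply/permP=> v.
  by have := eq_st v; rewrite !ffunE.
(* The first half of the word determines the permutation, so [rev_double] is injective. *)
rewrite /r -(@card_imset _ _ (@rev_double n)).
  apply: eq_card => w; rewrite !inE; apply/andP/imsetP => [[/imsetP[pi _ ->] av]|].
    by exists pi; rewrite ?inE.
  by case=> pi; rewrite inE => av ->; split=> //; apply: imset_f.
move=> s t eq_st; apply/permP => v.
have := congr1 (fun w => tnth w (lshift n v)) eq_st.
have nthE (pi : 'S_n) : tnth (rev_double pi) (lshift n v) = pi v.
  apply: (@perm_inj _ (pi^-1)%g); apply: val_inj.
  by rewrite permK /= position_rev_double /= ltn_ord.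
by rewrite !nthE.
Qed.

(** * Counting the parameters *)

Lemma sum_interval n l u : \sum_(i < n) (l <= i < u : nat) = minn u n - l.
Proof.
elim: n => [|n IHn]; first by rewrite big_ord0; lia.
by rewrite big_ord_recr /= IHn; lia.
Qed.

Lemma sum_rect n l u l' u' (F : nat -> nat -> bool) :
  (forall i j, i < n -> j < n -> F i j = (l <= i < u) && (l' <= j < u')) ->
  \sum_(i < n) \sum_(j < n) (F i j : nat) = (minn u n - l) * (minn u' n - l').
Proof.
move=> FE; rewrite -!sum_interval big_distrlr /=.
by apply: eq_bigr => i _; apply: eq_bigr => j _; rewrite FE ?mulnb.
Qed.

(** For [y = 1], [b = 1] and [z] has [n] choices without the swap, [n - 2] with it. For larger [y],
    [b] runs over 2, ..., [y] and [z] over [y - 1], ..., [n - 1]; the swap is possible iff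
    [y.+1 < n]. *)
Definition fiber_size (n y : nat) : nat :=
  if y == 1 then n + (n - 2) else (y - 1) * (n + 1 - y) * (1 + (y.+1 < n)).

Lemma card_params n : 1 < n -> #|params n| = \sum_(y < n) fiber_size n y.
Proof.
move=> n1; rewrite -sum1_card big_mkcond /=.
transitivity (\sum_(b < n) \sum_(y < n) \sum_(z < n) \sum_(e : bool)
    (param_ok n b y z e : nat)).
  rewrite !pair_bigA /=; apply: eq_bigr => -[[[b y] z] e] _.
  by rewrite inE; case: param_ok.
(* Once [y] and [e] are fixed, the conditions on [b] and [z] are independent intervals. *)
rewrite exchange_big /=; apply: eq_bigr => y _; have yn := ltn_ord y.
under eq_bigr do under eq_bigr do rewrite big_bool.
under eq_bigr do rewrite big_split.
rewrite big_split /= /fiber_size.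
have [y1|y1] := eqVneq (y : nat) 1.
  rewrite (@sum_rect n 1 2 0 (n - 2) (fun b z => param_ok n b y z true)).
    rewrite (@sum_rect n 1 2 0 n (fun b z => param_ok n b y z false)).
      have -> : minn 2 n = 2 by lia.
      by rewrite !mul1n; lia.
    by move=> b z bn zn; rewrite /param_ok; lia.
  by move=> b z bn zn; rewrite /param_ok; lia.
have H e : \sum_(b < n) \sum_(z < n) (param_ok n b y z e : nat) =
    (y + e < n) * ((y - 1) * (n + 1 - y)).
  case: (boolP (y + e < n)) => yen.
    rewrite (@sum_rect n 2 y.+1 y.-1 n (fun b z => param_ok n b y z e)).
      rewrite minnn (minn_idPl yn) subSS mul1n.
      by case: (y : nat) => [|k] //; congr (_ * _); lia.
    by move=> b z bn zn; rewrite /param_ok; lia.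
  by rewrite (@sum_rect n 0 0 0 0 (fun b z => param_ok n b y z e))
    ?min0n // => b z bn zn; rewrite /param_ok; lia.
by rewrite !H addn0 yn -mulnDl mulnC [_ + true]addnC [y + true]addn1.
Qed.

(** The range stops before [y = n - 1], so every fibre with [y >= 2] allows both values of [e];
    putting [k = y - 1], these contribute twice the sum of [k * (n - k)] over [k <= j]. The factor 3
    clears denominators. *)
Lemma sum_fiber_size n j : j.+2 < n ->
  3 * \sum_(y < j.+2) fiber_size n y =
  3 * (2 * n - 2) + j * j.+1 * (3 * n - 1 - 2 * j).
Proof.
elim: j => [|j IHj] jn.
  by rewrite !big_ord_recr big_ord0 /fiber_size /=; lia.
rewrite big_ord_recr mulnDr IHj; last lia.
have [d ->] : exists d, n = d + j + 4 by exists (n - j - 4); lia.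
rewrite /fiber_size /=; have -> : j.+3 < d + j + 4 by lia.
have -> : d + j + 4 + 1 - j.+2 = d + 3 by lia.
have -> : 3 * (d + j + 4) - 1 - 2 * j = 3 * d + j + 11 by lia.
have -> : 3 * (d + j + 4) - 1 - 2 * j.+1 = 3 * d + j + 9 by lia.
nia.
Qed.

Import GRing.Theory.
Local Open Scope ring_scope.

Theorem theorem9 (n : nat) (hn : (2 <= n)%N) :
  (r n p1243)%:R = n%:R ^+ 3 / 3%:R - 7%:R * n%:R / 3%:R + 4%:R :> rat.
Proof.
rewrite r1243_card // card_params //.
(* The claim cleared of denominators and subtraction; for [n > 2] the fibre [y = n - 1], where [e]
   is false, is added separately. *)
have E : (3 * \sum_(y < n) fiber_size n y + 7 * n = n ^ 3 + 12)%N.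
  case: n hn => [|[|[|k]]] // _; first by rewrite !big_ord_recr big_ord0.
  rewrite big_ord_recr /= mulnDr sum_fiber_size // /fiber_size /=.
  have -> : (k.+4 <= k.+3 = false)%N by lia.
  have -> : (k.+3 + 1 - k.+2 = 2)%N by lia.
  have -> : (3 * k.+3 - 1 - 2 * k = k + 8)%N by lia.
  nia.
have := congr1 (fun m => m%:R : rat) E; rewrite natrD [in RHS]natrD natrX !natrM => E'.
lra.
Qed.
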